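(* Let $H$ be a finite bipartite graph that is tree-arrangeable. Then $H$ has Sidorenko's property, i.e. for every finite simple graph $G$, \[ t_H(G) \ge t_{K_2}(G)^{|E(H)|}. \]
   Context: All graphs are finite and simple. For graphs $H,G$, $\mathrm{Hom}(H,G)$ is the set of homomorphisms $V(H)\to V(G)$ (maps sending edges to edges), and $t_H(G)=|\mathrm{Hom}(H,G)|/|V(G)|^{|V(H)|}$. A bipartite graph $H$ has Sidorenko's property if $t_H(G)\ge t_{K_2}(G)^{|E(H)|}$ for all graphs $G$. For a vertex $u$ of $H$, $\Lambda_u$ denotes its neighbourhood in $H$. An independent set $U$ of $H$ is $T$-arrangeable, for a tree $T$ with vertex set $U$, if $\Lambda_u\cap\Lambda_v=\bigcap_{w\in P}\Lambda_w$ for every $u,v\in U$ and the path $P$ in $T$ connecting $u$ and $v$. $U$ is tree-arrangeable if it is $T$-arrangeable for some tree $T$ on $U$, and a bipartite graph $H$ is tree-arrangeable if it has a bipartition $A\cup B$ such that $A$ is tree-arrangeable. *)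

(* Defs.v *)
From HB Require Import structures.
From mathcomp Require Import all_boot all_order all_algebra.

Set Implicit Arguments.
Unset Strict Implicit.
Unset Printing Implicit Defensive.

Import Order.TTheory GRing.Theory Num.Theory.

Record sgraph (V : finType) := SGraph {
  adj : rel V;
  adj_sym : symmetric adj;
  adj_irrefl : irreflexive adj }.

Section Graphs.
Variables (V : finType) (H : sgraph V).

Definition neighbourhood (u : V) : {set V} := [set x | adj H u x].

Definition edges : {set {set V}} :=
  [set [set p.1; p.2] | p in [set p : V * V | adj H p.1 p.2]].

Definition independent (U : {set V}) : Prop :=
  {in U &, forall x y, ~~ adj H x y}.

Definition bipartition (A B : {set V}) : Prop :=
  [/\ A :|: B = [set: V], [disjoint A & B], independent A & independent B].

Definition bipartite : Prop := exists A B : {set V}, bipartition A B.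

Definition graph_connected : Prop := forall x y : V, connect (adj H) x y.

(* A single edge traversed back and forth is a ucycle of size 2, whence the
   bound on the size. *)
Definition acyclic : Prop := forall c : seq V, ucycle (adj H) c -> size c <= 2.

Definition is_tree : Prop := [/\ 0 < #|V|, graph_connected & acyclic].

(* x :: p is a path from x to y without repeated vertices. *)
Definition simple_path (x y : V) (p : seq V) : Prop :=
  [/\ path (adj H) x p, uniq (x :: p) & last x p = y].

End Graphs.

Section Arrangeable.
Variables (V : finType) (H : sgraph V).

(* In a tree there is exactly one simple path from u to v, so quantifying over
   all of them is the same as speaking of the path from u to v. *)
Definition arrangeable (U : {set V}) (T : sgraph {u : V | u \in U}) : Prop :=
  [/\ independent H U, is_tree T &
    forall (u v : {u : V | u \in U}) (p : seq {u : V | u \in U}),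
      simple_path T u v p ->
      neighbourhood H (val u) :&: neighbourhood H (val v)
        = \bigcap_(w <- u :: p) neighbourhood H (val w)].

Definition tree_arrangeable_set (U : {set V}) : Prop :=
  exists T : sgraph {u : V | u \in U}, arrangeable T.

Definition tree_arrangeable : Prop :=
  exists A B : {set V}, bipartition H A B /\ tree_arrangeable_set A.

End Arrangeable.

Lemma complete_sym n : symmetric (fun x y : 'I_n => x != y).
Proof. by move=> x y; rewrite eq_sym. Qed.

Lemma complete_irrefl n : irreflexive (fun x y : 'I_n => x != y).
Proof. by move=> x; rewrite eqxx. Qed.

Definition complete_graph n : sgraph 'I_n :=
  SGraph (@complete_sym n) (@complete_irrefl n).

Definition homs (V W : finType) (H : sgraph V) (G : sgraph W) :
    {set {ffun V -> W}} :=
  [set f : {ffun V -> W} |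
    [forall x, forall y, adj H x y ==> adj G (f x) (f y)]].

Definition hom_density (V W : finType) (H : sgraph V) (G : sgraph W) : rat :=
  (#|homs H G|%:R / #|W|%:R ^+ #|V|)%R.

(* G must have at least one vertex for its densities to make sense. *)
Definition sidorenko (V : finType) (H : sgraph V) : Prop :=
  forall (W : finType) (G : sgraph W), 0 < #|W| ->
    (hom_density (complete_graph 2) G ^+ #|edges H| <= hom_density H G)%R.

(* Main.v *)
Require Import Defs.
From mathcomp Require Import all_boot all_order all_algebra.
From mathcomp Require Import reals exp Rstruct ring lra.
From Stdlib Require Rdefinitions.

(* Let p be the edge density of G, and let A be the
   tree-arrangeable side of H. Process A along the tree, each vertex after its
   parent, and build a random homomorphism H -> G: a new vertex v together with
   its neighbours is a star with degree-biased centre and uniform neighbours of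
   the centre as leaves. Arrangeability says that the already placed neighbours
   of v are neighbours of its parent u, and the joint law of any set of leaves
   of such a star depends only on that set, so the new star can be glued, by
   conditional independence, to what was built before.

   All laws are represented by densities with respect to the uniform law on all
   maps V(H) -> V(G), so unplaced vertices are uniform. Gluing v multiplies the
   density by star/leaves; the corresponding relative entropy grows by at most
   d(v) ln(1/p), because both the degree-biased law and the law of the leaves
   have nonnegative relative entropy. The final law lives on Hom(H, G) and has
   relative entropy at most |E(H)| ln(1/p), which forces t_H(G) >= p^|E(H)|. *)

Set Implicit Arguments.
Unset Strict Implicit.
Unset Printing Implicit Defensive.

Import Order.TTheory GRing.Theory Num.Theory.

(** * Growing a connected graph one vertex at a time *)

(** [P] is enlarged along an edge leaving it, which gives the new vertex [v] a parent [u] in [P]. A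
    simple path from [u] inside [P] stays simple when [v] is put in front. *)
Lemma connected_graph_ind (T : finType) (K : sgraph T) (Q : {set T} -> Prop) :
  graph_connected K -> Q set0 ->
  (forall (P : {set T}) v, v \notin P -> Q P ->
     P = set0 \/ (exists2 u, u \in P &
       forall w, w \in P -> exists p, simple_path K v w (u :: p)) ->
     Q (v |: P)) ->
  Q [set: T].
Proof.
move=> conn Q0 QS.
pose inn (P : {set T}) : rel T := fun x y => [&& adj K x y, x \in P & y \in P].
(* Connectivity by edges inside [P] is part of the induction, since it supplies paths from [u] that
   avoid [v]. *)
have extend k : (k <= #|T|)%N -> exists2 P : {set T}, #|P| = k &
    Q P /\ {in P &, forall x y, connect (inn P) x y}.
  elim: k => [|k IH] lekT.
    by exists set0; rewrite ?cards0 //; split=> // x y; rewrite inE.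
  have [P cardP [QP connP]] := IH (ltnW lekT).
  have [v vP [crossing|P0]]: exists2 v, v \notin P &
      (exists2 u, u \in P & adj K u v) \/ P = set0.
  - have [P0|[x xP]] := set_0Vmem P.
      have /card_gt0P[v _] : (0 < #|T|)%N by apply: leq_trans lekT.
      by exists v; [rewrite P0 inE | right].
    have [y yP] : exists y, y \notin P.
      have /subsetPn[y _ yP] : ~~ ([set: T] \subset P).
        apply: contraTN lekT => /subset_leq_card.
        by rewrite cardsT cardP leqNgt.
      by exists y.
    have [/exists_inP[u uP /exists_inP[v vP uv]]|nocross] :=
      boolP [exists u in P, exists v in ~: P, adj K u v].
      by exists v; [rewrite inE in vP | left; exists u].
    (* Without a crossing edge [P] is closed under adjacency, yet [x] in [P] is connected to [y]
       outside it. *)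
    have clP : closed (adj K) (mem P).
      apply: intro_closed => [|a b ab aP].
        by apply: sym_connect_sym; exact: (@adj_sym _ K).
      apply: contraNT nocross => bP.
      apply/exists_inP; exists a => //.
      by apply/exists_inP; exists b; rewrite ?inE.
    by move: yP; rewrite -(closed_connect clP (conn x y)) xP.
  - case: crossing => u uP uv.
    exists (v |: P); first by rewrite cardsU1 vP cardP add1n.
    have subP : subrel (connect (inn P)) (connect (inn (v |: P))).
      apply: connect_sub => a b /and3P[ab aP bP]; apply: connect1.
      by rewrite /inn ab !inE aP bP !orbT.
    have uv' : inn (v |: P) u v by rewrite /inn uv !inE uP eqxx orbT.
    have vu' : inn (v |: P) v u by rewrite /inn adj_sym uv !inE uP eqxx orbT.
    split.
      apply: QS => //; right; exists u => // w wP.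
      have /connectP[p0 p0P ->] := connP _ _ uP wP.
      case/shortenP: p0P => p pP up _; exists p; split=> //=.
        rewrite adj_sym uv /=; apply: sub_path pP.
        by move=> a b /and3P[].
      rewrite -cons_uniq cons_uniq up andbT.
      have upP : all (mem P) (u :: p).
        rewrite /= uP /=; elim: (p) (u) pP {up} => //= b p' IHp a.
        by case/andP=> /and3P[_ _ bP] /IHp ->; rewrite bP.
      by apply: contra vP => /(allP upP).
    move=> x y; rewrite !inE => /predU1P[->|xP] /predU1P[->|yP].
    - exact: connect0.
    - by apply: (connect_trans (connect1 vu')); apply: subP; apply: connP.
    - by apply: connect_trans (connect1 uv'); apply: subP; apply: connP.
    - by apply: subP; apply: connP.
  - exists (v |: P); first by rewrite cardsU1 vP cardP add1n.
    split; first by apply: QS => //; left.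
    by move=> x y; rewrite P0 setU0 !inE => /eqP-> /eqP->; exact: connect0.
have [P cardP [QP _]] := extend #|T| (leqnn _).
suff <- : P = [set: T] by [].
by apply/eqP; rewrite eqEcard subsetT cardsT cardP leqnn.
Qed.

(** * Averages over all maps, marginals and relative entropy *)

Local Open Scope ring_scope.

(** This is [ln (1 + t) <= t] at [t = x^-1 - 1], multiplied by [x]. Both entropy bounds below are
    averages of it. *)
Lemma xlnx_ge (R : realType) (x : R) : 0 <= x -> x - 1 <= x * ln x.
Proof.
rewrite le_eqVlt => /predU1P[<-|x0]; first by rewrite mul0r sub0r lerN10.
have := @le_ln1Dx R (x^-1 - 1); rewrite ltrBrDl subrr invr_gt0 => /(_ x0).
rewrite addrC subrK lnV ?posrE // -(ler_pM2l x0) mulrBr divff ?gt_eqF //.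
by rewrite mulrN mulr1; lra.
Qed.

Section Mean.
Variables (R : realType) (V W : finType).
Hypothesis W_gt0 : (0 < #|W|)%N.
Implicit Types (h : {ffun V -> W}) (f g : {ffun V -> W} -> R) (D : {set V}).

Let n : R := #|W|%:R.

Let n_neq0 : n != 0.
Proof. by rewrite pnatr_eq0 -lt0n. Qed.

Definition update h (b : V) (y : W) : {ffun V -> W} :=
  [ffun x => if x == b then y else h x].

Definition mean f : R := (\sum_h f h) / n ^+ #|V|.

(** Conditional expectation given all coordinates except [b]. *)
Definition mean_at (b : V) f : {ffun V -> W} -> R :=
  fun h => (\sum_y f (update h b y)) / n.

Definition depends_on D f : Prop :=
  forall h h', {in D, h =1 h'} -> f h = f h'.

Lemma eq_mean f g : f =1 g -> mean f = mean g.
Proof. by move=> fg; rewrite /mean (eq_bigr g) // => h _; rewrite fg. Qed.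

Lemma meanD f g : mean (fun h => f h + g h) = mean f + mean g.
Proof. by rewrite /mean big_split mulrDl. Qed.

Lemma meanZ c f : mean (fun h => c * f h) = c * mean f.
Proof. by rewrite /mean -mulr_sumr mulrA. Qed.

Lemma ler_mean f g : (forall h, f h <= g h) -> mean f <= mean g.
Proof.
move=> fg; rewrite /mean ler_wpM2r ?invr_ge0 ?exprn_ge0 ?ler0n //.
exact: ler_sum.
Qed.

Lemma mean_cst c : mean (fun=> c) = c.
Proof.
rewrite /mean sumr_const card_ffun -mulr_natr natrX mulfK //.
by rewrite expf_neq0.
Qed.

(** Exchanging [y] with [h b] is an involution on the pairs [(h, y)]; it turns the double sum into
    [#|W|] copies of the sum of [f]. *)
Lemma mean_mean_at b f : mean (mean_at b f) = mean f.
Proof.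
rewrite /mean /mean_at -mulr_suml -mulrA -invfM.
rewrite -[in RHS](mulfK n_neq0 (\sum_h f h)).
rewrite -[RHS]mulrA -invfM [n * _]mulrC; congr (_ / _).
rewrite pair_big /=.
pose s (p : {ffun V -> W} * W) := (update p.1 b p.2, p.1 b).
have sK : involutive s.
  move=> [h y]; rewrite /s /=; congr pair; last by rewrite ffunE eqxx.
  by apply/ffunP=> x; rewrite !ffunE; case: eqP => [->|].
rewrite (reindex_inj (inv_inj sK)) /=.
rewrite (eq_bigr (fun p => f p.1)) => [|[h y] _ /=]; last first.
  by congr f; apply/ffunP=> x; rewrite !ffunE; case: eqP => [->|].
rewrite -(pair_big predT predT (fun h (y : W) => f h)) /= mulr_suml.
by apply: eq_bigr => h _; rewrite sumr_const -mulr_natr.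
Qed.

Lemma depends_onS D D' f : D \subset D' -> depends_on D f -> depends_on D' f.
Proof. by move=> /subsetP DD' fD h h' hh'; apply: fD => x /DD' /hh'. Qed.

Lemma depends_onM D f g :
  depends_on D f -> depends_on D g -> depends_on D (fun h => f h * g h).
Proof. by move=> fD gD h h' hh'; rewrite (fD _ h') // (gD _ h'). Qed.

Lemma depends_on_comp D f (F : R -> R) :
  depends_on D f -> depends_on D (fun h => F (f h)).
Proof. by move=> fD h h' hh'; rewrite (fD _ h'). Qed.

Lemma depends_on_update b y h f : depends_on (~: [set b]) f ->
  f (update h b y) = f h.
Proof.
by apply=> x; rewrite !inE ffunE => /negPf->.
Qed.

Lemma mean_atM b f g : depends_on (~: [set b]) g ->
  mean_at b (fun h => g h * f h) =1 (fun h => g h * mean_at b f h).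
Proof.
move=> gb h; rewrite /mean_at mulrA mulr_sumr; congr (_ / _).
by apply: eq_bigr => y _; rewrite depends_on_update.
Qed.

Lemma mean_mul_mean_at b f g : depends_on (~: [set b]) g ->
  mean (fun h => g h * mean_at b f h) = mean (fun h => g h * f h).
Proof. by move=> gb; rewrite -(eq_mean (mean_atM f gb)) mean_mean_at. Qed.

Lemma depends_on_mean_at b D f :
  depends_on D f -> depends_on (D :\ b) (mean_at b f).
Proof.
move=> fD h h' hh'; rewrite /mean_at; congr (_ / _); apply: eq_bigr => y _.
apply: fD => x xD; rewrite !ffunE; case: eqP => // /eqP xb.
by apply: hh'; rewrite !inE xb.
Qed.

(** [f'] is the conditional expectation of [f] given the coordinates outside [C], obtained by
    averaging over those in [C] one by one. *)
Lemma mean_project C D f : depends_on D f ->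
  exists2 f' : {ffun V -> W} -> R, depends_on (D :\: C) f' &
    forall g, depends_on (~: C) g ->
      mean (fun h => g h * f h) = mean (fun h => g h * f' h).
Proof.
move=> fD; have [k] := ubnP #|C|; elim: k C => // k IH C leCk.
have [->|[b bC]] := set_0Vmem C; first by exists f; rewrite ?setD0.
have [|f1 f1D f1E] := IH (C :\ b).
  by rewrite (cardsD1 b) bC add1n in leCk.
exists (mean_at b f1) => [|g gC].
  apply: depends_onS (depends_on_mean_at (b := b) f1D).
  apply/subsetP=> x; rewrite !inE => /and3P[xb].
  by rewrite negb_and xb => /= -> ->.
have gS (C' : {set V}) : C' \subset C -> depends_on (~: C') g.
  by move=> CC'; apply: depends_onS gC; rewrite setCS.
rewrite mean_mul_mean_at ?f1E //; apply: gS; first exact: subD1set.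
by rewrite sub1set.
Qed.

Lemma mean_neq0_exists_gt0 f :
  (forall h, 0 <= f h) -> mean f != 0 -> exists h, 0 < f h.
Proof.
move=> f0 mf; apply/existsP; apply: contraNT mf => /existsPn nf.
rewrite -(mean_cst 0); apply/eqP/eq_mean => h; apply/eqP.
by rewrite eq_le f0 andbT leNgt nf.
Qed.

Lemma mean_xlnx_ge0 f : (forall h, 0 <= f h) -> mean f = 1 ->
  0 <= mean (fun h => f h * ln (f h)).
Proof.
move=> f0 f1; apply: le_trans (ler_mean (fun h => xlnx_ge (f0 h))).
by rewrite meanD f1 mean_cst subrr.
Qed.

(** Gibbs' inequality against the uniform law on [X]: [xlnx_ge] at [f h * t] is averaged, and its
    left side averages to [t - t = 0]. *)
Lemma mean_supported f (X : {set {ffun V -> W}}) :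
  (forall h, 0 <= f h) -> (forall h, f h != 0 -> h \in X) -> mean f = 1 ->
  - ln (mean (fun h => (h \in X)%:R)) <= mean (fun h => f h * ln (f h)).
Proof.
move=> f0 fX f1; set t : R := mean _.
have t_gt0 : 0 < t.
  have [h hf] : exists h, 0 < f h.
    by apply: mean_neq0_exists_gt0 => //; rewrite f1 oner_eq0.
  rewrite divr_gt0 ?exprn_gt0 ?ltr0n // (bigD1 h) //= fX ?gt_eqF //.
  by rewrite ltr_pwDl ?ltr01 // sumr_ge0.
have : mean (fun h => f h * t - (h \in X)%:R) <=
       mean (fun h => t * (f h * ln (f h)) + ln t * t * f h).
  apply: ler_mean => h; have [->|fn0] := eqVneq (f h) 0.
    by rewrite !(mul0r, mulr0) sub0r addr0 oppr_le0.
  have f_gt0 : 0 < f h by rewrite lt_def fn0 f0.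
  have := @xlnx_ge R (f h * t); rewrite fX // lnM ?posrE // => H1.
  apply: le_trans (H1 (ltW (mulr_gt0 f_gt0 t_gt0))) _.
  by rewrite le_eqVlt; apply/orP; left; apply/eqP; ring.
rewrite !meanD !meanZ f1.
have -> : mean (fun h => f h * t) = t.
  rewrite (eq_mean (g := fun h => t * f h)) ?meanZ ?f1 ?mulr1 // => h.
  by rewrite mulrC.
have -> : mean (fun h => - (h \in X)%:R) = - t.
  rewrite (eq_mean (g := fun h => -1 * (h \in X)%:R)) ?meanZ ?mulN1r // => h.
  by rewrite mulN1r.
rewrite subrr mulr1 [ln t * t]mulrC -mulrDr pmulr_rge0 //.
by rewrite -lerBlDr sub0r.
Qed.

End Mean.

(** * Stars with a degree-biased centre *)

Section Stars.
Variables (R : realType) (V W : finType) (G : sgraph W).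
Hypothesis W_gt0 : (0 < #|W|)%N.
Implicit Types (h : {ffun V -> W}) (f g : {ffun V -> W} -> R) (S : {set V}).

Let n : R := #|W|%:R.

Definition degree (x : W) : R := #|neighbourhood G x|%:R.

Definition degree_sum : R := \sum_x degree x.

Definition edge_density : R := degree_sum / n ^+ 2.

(* Density, with respect to the uniform law on [W], of the law of a vertex
   chosen with probability proportional to its degree. *)
Definition degree_density (x : W) : R := degree x * n / degree_sum.

(* Density of a uniform neighbour of [x]; identically [0] if [x] is isolated. *)
Definition step_density (x y : W) : R := (adj G x y)%:R * n / degree x.

Definition star_density (v : V) S h : R :=
  degree_density (h v) * \prod_(b in S) step_density (h v) (h b).

(** Marginal of the star law on its leaves. Averaging out the centre removes every trace of [v]. *)
Definition leaf_density S h : R :=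
  (\sum_x degree_density x * \prod_(b in S) step_density x (h b)) / n.

Hypothesis degree_sum_gt0 : 0 < degree_sum.

Let n_gt0 : 0 < n.
Proof. by rewrite ltr0n. Qed.

Let n_neq0 : n != 0.
Proof. by rewrite gt_eqF. Qed.

Lemma edge_density_gt0 : 0 < edge_density.
Proof. by rewrite divr_gt0 ?exprn_gt0. Qed.

Lemma sum_adj x : \sum_y (adj G x y)%:R = degree x.
Proof.
rewrite /degree -sum1_card natr_sum [RHS]big_mkcond /=.
by apply: eq_bigr => y _; rewrite inE; case: adj.
Qed.

Lemma degree_ge0 x : 0 <= degree x.
Proof. exact: ler0n. Qed.

Lemma degree_gt0 x y : adj G x y -> 0 < degree x.
Proof. by move=> xy; rewrite ltr0n; apply/card_gt0P; exists y; rewrite inE. Qed.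

Lemma degree_density_ge0 x : 0 <= degree_density x.
Proof. by rewrite divr_ge0 ?mulr_ge0 ?degree_ge0 // ltW. Qed.

Lemma step_density_ge0 x y : 0 <= step_density x y.
Proof. by rewrite divr_ge0 ?mulr_ge0 ?degree_ge0 ?ler0n // ltW. Qed.

Lemma step_density_adj x y : adj G x y -> step_density x y = n / degree x.
Proof. by rewrite /step_density => ->; rewrite mul1r. Qed.

Lemma star_density_ge0 v S h : 0 <= star_density v S h.
Proof.
rewrite mulr_ge0 ?degree_density_ge0 // prodr_ge0 // => b _.
exact: step_density_ge0.
Qed.

Lemma leaf_density_ge0 S h : 0 <= leaf_density S h.
Proof.
rewrite divr_ge0 ?(ltW n_gt0) // sumr_ge0 // => x _.
rewrite mulr_ge0 ?degree_density_ge0 // prodr_ge0 // => b _.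
exact: step_density_ge0.
Qed.

Lemma star_density_adj v S h b :
  star_density v S h != 0 -> b \in S -> adj G (h v) (h b).
Proof.
move=> + bS; apply: contraNT => /negPf nadj.
by rewrite /star_density (bigD1 b) //= /step_density nadj !mul0r mulr0.
Qed.

Lemma leaf_density0 h : leaf_density set0 h = 1.
Proof.
rewrite /leaf_density (eq_bigr (fun x => degree x * (n / degree_sum))).
  by rewrite -mulr_suml -/degree_sum; field; rewrite n_neq0 gt_eqF.
by move=> x _; rewrite big_set0 mulr1 /degree_density mulrA.
Qed.

Lemma leaf_density_gt0 S h x : {in S, forall b, adj G x (h b)} ->
  0 < leaf_density S h.
Proof.
(* For empty [S] the vertex [x] may be isolated and its own term may vanish, so the total mass 1 is
   used instead. *)
move=> xS; have [S0|[b bS]] := set_0Vmem S.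
  by rewrite S0 leaf_density0.
have dx := degree_gt0 (xS b bS).
rewrite divr_gt0 // (bigD1 x) //= ltr_pwDl //.
  rewrite mulr_gt0 ?divr_gt0 ?mulr_gt0 // prodr_gt0 // => c cS.
  by rewrite step_density_adj ?divr_gt0 ?xS.
rewrite sumr_ge0 // => y _.
rewrite mulr_ge0 ?degree_density_ge0 // prodr_ge0 // => c _.
exact: step_density_ge0.
Qed.

Lemma depends_on_star v S : depends_on (v |: S) (star_density v S).
Proof.
move=> h h' hh'; rewrite /star_density hh' ?setU11 //; congr (_ * _).
by apply: eq_bigr => b bS; rewrite hh' // setU1r.
Qed.

Lemma depends_on_leaf S : depends_on S (leaf_density S).
Proof.
move=> h h' hh'; rewrite /leaf_density; congr (_ / _).
apply: eq_bigr => x _; congr (_ * _).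
by apply: eq_bigr => b bS; rewrite hh'.
Qed.

Lemma mean_at_leaf v S b : v \notin S -> b \in S ->
  mean_at b (star_density v S) =1 star_density v (S :\ b).
Proof.
move=> vS bS h; have vb : v != b by apply: contraNneq vS => ->.
rewrite /mean_at (eq_bigr (fun y => star_density v (S :\ b) h *
   step_density (h v) y)) => [|y _]; last first.
  rewrite /star_density (big_setD1 b) //= !ffunE eqxx (negPf vb).
  rewrite [RHS]mulrAC [LHS]mulrA; congr (_ * _); apply: eq_bigr => c.
  by rewrite !inE ffunE => /andP[/negPf->].
rewrite -mulr_sumr.
have -> : \sum_y step_density (h v) y = degree (h v) * (n / degree (h v)).
  rewrite -{1}sum_adj mulr_suml; apply: eq_bigr => y _.
  by rewrite /step_density mulrA.
(* At an isolated centre the steps have total mass 0 instead of [n], but there [degree_density]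
   vanishes as well. *)
have [d0|d0] := eqVneq (degree (h v)) 0.
  by rewrite /star_density /degree_density d0 !mul0r.
by field; rewrite d0 n_neq0.
Qed.

Lemma mean_star_sub v S S' g : v \notin S -> S' \subset S ->
  depends_on (~: (S :\: S')) g ->
  mean (fun h => g h * star_density v S h) =
  mean (fun h => g h * star_density v S' h).
Proof.
have [k] := ubnP #|S|; elim: k S => // k IH S leSk vS S'S gS.
have [SS'|] := eqVneq S' S; first by rewrite SS'.
rewrite eqEsubset S'S /= => /subsetPn[b bS bS'].
rewrite -(mean_mul_mean_at W_gt0 (b := b)); last first.
  by apply: depends_onS gS; rewrite setCS sub1set inE bS' bS.
rewrite -(IH (S :\ b)).
- by apply: eq_mean => h; rewrite mean_at_leaf.
- by rewrite (cardsD1 b S) bS add1n in leSk.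
- by rewrite inE (negPf vS) andbF.
- by apply/subsetP=> x xS'; rewrite !inE (subsetP S'S) // andbT;
     apply: contraNneq bS' => <-.
- apply: depends_onS gS; rewrite setCS; apply: setSD; exact: subD1set.
Qed.

(** Averaging out the leaves outside [S'] and then the centre gives a law that depends on neither
    [v] nor [S]. This is why two stars agree on common leaves. *)
Lemma mean_star_leaf v S S' g : v \notin S -> S' \subset S ->
  depends_on (~: (v |: (S :\: S'))) g ->
  mean (fun h => g h * star_density v S h) =
  mean (fun h => g h * leaf_density S' h).
Proof.
move=> vS S'S gS; rewrite (@mean_star_sub v S S') //; last first.
  by apply: depends_onS gS; rewrite setCS subsetUr.
rewrite -(mean_mul_mean_at W_gt0 (b := v)); last first.
  by apply: depends_onS gS; rewrite setCS subsetUl.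
apply: eq_mean => h; congr (_ * (_ / _)); apply: eq_bigr => x _.
rewrite /star_density ffunE eqxx; congr (_ * _); apply: eq_bigr => b bS.
rewrite ffunE; case: eqP => // bv.
by case/negP: vS; rewrite -bv (subsetP S'S).
Qed.

(** On the support each leaf contributes [n / degree], the inverse of
    [edge_density * degree_density] at the centre. The centre's own factor cancels one
    [degree_density], whence [#|S|.-1]. *)
Lemma ln_star_density v S h : (0 < #|S|)%N -> star_density v S h != 0 ->
  ln (star_density v S h) =
  #|S|%:R * - ln edge_density - #|S|.-1%:R * ln (degree_density (h v)).
Proof.
move=> S_gt0 sn0; have /card_gt0P[b bS] := S_gt0.
have adjS := star_density_adj sn0.
have dx := degree_gt0 (adjS b bS).
have rx : 0 < degree_density (h v) by rewrite divr_gt0 ?mulr_gt0.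
rewrite /star_density (eq_bigr (fun=> n / degree (h v))) => [|c cS]; last first.
  by rewrite step_density_adj // adjS.
have -> : n / degree (h v) = (edge_density * degree_density (h v))^-1.
  rewrite /edge_density /degree_density; field.
  by rewrite n_neq0 !gt_eqF.
have e0 := edge_density_gt0; have er0 := mulr_gt0 e0 rx.
rewrite prodr_const lnM ?posrE ?exprn_gt0 ?invr_gt0 //.
rewrite lnXn ?invr_gt0 // lnV ?posrE // lnM ?posrE //.
by rewrite -(prednK S_gt0) /= -mulr_natl -natr1; ring.
Qed.

(** * Gluing stars by conditional independence *)

Section Gluing.
Variable H : sgraph V.
Notation N := (neighbourhood H).
Implicit Type P : {set V}.

Definition covered P : {set V} := \bigcup_(u in P) N u.

(** The leaf sets on which the marginal is prescribed. The empty set is listed separately so that it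
    is available even for empty [P]. *)
Definition inside_star P S : Prop :=
  S = set0 \/ exists2 u, u \in P & S \subset N u.

(** The invariant of the induction. Its fourth clause states, through test functions [f], that the
    marginal on [S] is the leaf law; the case of empty [S] and [f = 1] is normalisation. *)
Definition glued_density P (rho : {ffun V -> W} -> R) : Prop :=
  [/\ forall h, 0 <= rho h,
      depends_on (P :|: covered P) rho,
      forall h, rho h != 0 ->
        {in P, forall u, {in N u, forall b, adj G (h u) (h b)}},
      forall S, inside_star P S -> forall f, depends_on S f ->
        mean (fun h => rho h * f h) = mean (fun h => leaf_density S h * f h) &
      mean (fun h => rho h * ln (rho h)) <=
        (\sum_(u in P) #|N u|)%:R * - ln edge_density].

Lemma glued_density0 : glued_density set0 (fun=> 1).
Proof.
split=> //.
- by move=> h _ u; rewrite inE.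
- move=> S [->|[u]]; last by rewrite inE.
  by move=> f _; apply: eq_mean => h; rewrite leaf_density0.
- by rewrite big_set0 mul0r ln1 mulr0 mean_cst.
Qed.

Lemma glued_density_mean P rho : glued_density P rho -> mean rho = 1.
Proof.
case=> _ _ _ /(_ set0 (or_introl erefl) (fun=> 1)) rhoE _.
rewrite -(mean_cst V W_gt0 1) (eq_mean (g := fun h => rho h * 1)); last first.
  by move=> h; rewrite mulr1.
by rewrite rhoE //; apply: eq_mean => h; rewrite leaf_density0 mulr1.
Qed.

(** Such a [v] stays uniform: a degree-biased [v] could add entropy, while its allowance [#|N v|] is
    0. *)
Lemma glued_density_isolated P v rho :
  v \notin P -> N v = set0 -> glued_density P rho -> glued_density (v |: P) rho.
Proof.
move=> vP Nv0 [rho0 rhoD rhoG rhoE rhoH]; split=> //.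
- apply: depends_onS rhoD; rewrite /covered big_setU1 //= Nv0 set0U.
  by rewrite setSU // subsetUr.
- move=> h /rhoG hP u; rewrite !inE => /predU1P[->|/hP //] b.
  by rewrite Nv0 inE.
- move=> S SP; apply: rhoE; case: SP => [->|[u]]; first by left.
  rewrite !inE => /predU1P[->|uP] Su; last by right; exists u.
  by left; apply/eqP; rewrite -subset0 -Nv0.
- by rewrite big_setU1 //= Nv0 cards0.
Qed.

(** With [S] the already placed neighbours of [v], both [rho] and the star [sigma] have marginal
    [tau] on [S]. Hence [rho * sigma / tau] extends both laws. *)
Lemma glued_density_extend P v rho :
  v \notin P -> v \notin covered P -> [disjoint N v & P] -> N v != set0 ->
  inside_star P (N v :&: covered P) -> glued_density P rho ->
  exists rho', glued_density (v |: P) rho'.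
Proof.
move=> vP vC NvP Nv0 Sgood rhoP.
have [rho0 rhoD rhoG rhoE rhoH] := rhoP.
set S := N v :&: covered P in Sgood.
have vNv : v \notin N v by rewrite inE adj_irrefl.
have SNv : S \subset N v by exact: subsetIl.
pose sigma := star_density v (N v); pose tau := leaf_density S.
have oldC : P :|: covered P \subset ~: (v |: (N v :\: S)).
  apply/subsetP=> x xPC; rewrite inE; apply/negP.
  rewrite in_setU1 in_setD in_setI => /predU1P[xv|].
    by move: xPC; rewrite xv inE (negPf vP) (negPf vC).
  case/andP=> + xN; rewrite xN /=; case/setUP: xPC => [xP|-> //] _.
  by have /disjointFr/(_ xN) := NvP; rewrite xP.
have SC : S \subset ~: (v |: (N v :\: S)).
  by apply: subset_trans oldC; rewrite subsetU // subsetIr orbT.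
(* Division by [tau] is harmless: where [rho] or [sigma] is nonzero, the images of [S] have a common
   neighbour, [h u] or [h v] respectively, unless [S] is empty and [tau] is 1. *)
have tau_gt0 h : rho h != 0 -> 0 < tau h.
  move=> /rhoG hP; case: Sgood => [S0|[u uP Su]].
    by rewrite /tau S0 leaf_density0.
  by apply: (@leaf_density_gt0 _ _ (h u)) => b bS; rewrite hP // (subsetP Su).
have sigma_tau h : sigma h != 0 -> 0 < tau h.
  move=> sn0; apply: (@leaf_density_gt0 _ _ (h v)) => b bS.
  by apply: star_density_adj sn0 _; apply: (subsetP SNv).
pose rho' h := rho h * sigma h / tau h.
have tauVD : depends_on S (fun h => (tau h)^-1).
  exact: depends_on_comp (@depends_on_leaf S).
(* The marginal on old coordinates is unchanged: averaging out [v] and the new leaves turns [sigma]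
   into [tau], which cancels. *)
have rho'_old g : depends_on (~: (v |: (N v :\: S))) g ->
    mean (fun h => rho' h * g h) = mean (fun h => rho h * g h).
  move=> gC.
  transitivity (mean (fun h => (rho h * g h / tau h) * sigma h)).
    by apply: eq_mean => h; rewrite /rho'; ring.
  rewrite (@mean_star_leaf v (N v) S) //; last first.
    apply: depends_onM; last exact: depends_onS tauVD.
    by apply: depends_onM => //; apply: depends_onS rhoD.
  apply: eq_mean => h; have [->|/tau_gt0 t0] := eqVneq (rho h) 0.
    by rewrite !mul0r.
  by rewrite mulfVK // gt_eqF.
(* The marginal on the new star is [sigma]: [f * sigma] is projected to a function [f'] of [S],
   against which [rho] acts as [tau]; after cancellation the projection is undone. *)
have rho'_new f : depends_on (v |: N v) f ->
    mean (fun h => rho' h * f h) = mean (fun h => f h * sigma h).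
  move=> fD.
  have [|f' f'D f'E] := @mean_project R V W W_gt0 (v |: (N v :\: S)) (v |: N v)
    (fun h => f h * sigma h).
    by apply: depends_onM => //; exact: depends_on_star.
  have {}f'D : depends_on S f'.
    apply: depends_onS f'D; apply/subsetP=> x.
    rewrite !inE; case: eqP => //= _.
    by case: (_ \in covered P); rewrite ?andbF ?andbT ?andNb.
  transitivity (mean (fun h => rho h / tau h * (f h * sigma h))).
    by apply: eq_mean => h; rewrite /rho'; ring.
  rewrite f'E; last first.
    by apply: depends_onM; [exact: depends_onS rhoD | exact: depends_onS tauVD].
  transitivity (mean (fun h => rho h * (f' h / tau h))).
    by apply: eq_mean => h; ring.
  rewrite (rhoE S) //; last exact: depends_onM.
  transitivity (mean (fun h => tau h / tau h * f' h)).
    by apply: eq_mean => h; rewrite /tau; ring.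
  rewrite -f'E; last first.
    by apply: depends_onS SC _; apply: depends_onM => //; exact: depends_on_leaf.
  apply: eq_mean => h; have [->|/sigma_tau t0] := eqVneq (sigma h) 0.
    by rewrite !mulr0.
  by rewrite divff ?mul1r // gt_eqF.
have rho'_neq0 h : rho' h != 0 -> [/\ rho h != 0, sigma h != 0 & 0 < tau h].
  rewrite !mulf_eq0 !negb_or => /andP[/andP[r0 s0] _].
  by split=> //; exact: tau_gt0.
exists rho'; split.
- move=> h; apply: divr_ge0; last exact: leaf_density_ge0.
  by apply: mulr_ge0; [exact: rho0 | exact: star_density_ge0].
- have covE : covered (v |: P) = N v :|: covered P.
    by rewrite /covered big_setU1.
  have PC : P :|: covered P \subset (v |: P) :|: covered (v |: P).
    by rewrite covE; apply: setUSS; rewrite subsetUr.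
  apply: depends_onM; first apply: depends_onM.
  + exact: depends_onS rhoD.
  + apply: depends_onS (@depends_on_star v (N v)).
    by rewrite covE; apply: setUSS; rewrite subsetUl.
  + apply: depends_onS tauVD; apply: subset_trans PC.
    by rewrite subsetU // subsetIr orbT.
- move=> h /rho'_neq0[rn0 sn0 _] u; rewrite !inE => /predU1P[->|uP] b bN.
    exact: star_density_adj sn0 _.
  exact: rhoG.
- have old S0 : inside_star P S0 -> forall f, depends_on S0 f ->
    mean (fun h => rho' h * f h) = mean (fun h => leaf_density S0 h * f h).
    move=> S0P f fD; rewrite rho'_old; first exact: rhoE.
    apply: depends_onS fD; apply: subset_trans oldC.
    case: S0P => [->|[u uP Su]]; first exact: sub0set.
    apply: subset_trans (subsetUr _ _); apply: subset_trans Su _.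
    by rewrite /covered (bigD1 u) //= subsetUl.
  move=> S0 [->|[u uP Su]] f fD; first by apply: old => //; left.
  case/setU1P: uP => [uv|uP]; last by apply: old => //; right; exists u.
  rewrite uv in Su; rewrite rho'_new; last first.
    by apply: depends_onS fD; rewrite subsetU // Su orbT.
  rewrite (@mean_star_leaf v (N v) S0) //.
    by apply: eq_mean => h; rewrite mulrC.
  apply: depends_onS fD; apply/subsetP => x xS0.
  rewrite !inE xS0 /= orbF; apply: contraNneq vNv => xv.
  by have := subsetP Su _ xS0; rewrite xv.
- have Nv_gt0 : (0 < #|N v|)%N by rewrite card_gt0.
  (* [ln rho'] is split as [ln rho + ln sigma - ln tau]. The first term gives the old entropy, the
     second term of the sum the allowance of [v], and the last two are nonpositive. *)
  have -> : mean (fun h => rho' h * ln (rho' h)) =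
     mean (fun h => rho' h * ln (rho h) +
     (#|N v|%:R * - ln edge_density * rho' h +
      (- #|N v|.-1%:R * (rho' h * ln (degree_density (h v))) +
      -1 * (rho' h * ln (tau h))))).
    apply: eq_mean => h.
    have [->|] := eqVneq (rho' h) 0; first by rewrite !mul0r !mulr0 !addr0.
    move=> r'n0; have [rn0 sn0 t0] := rho'_neq0 h r'n0.
    have r_gt0 : 0 < rho h by rewrite lt_def rn0 rho0.
    have s_gt0 : 0 < sigma h by rewrite lt_def sn0 star_density_ge0.
    have rs_gt0 := mulr_gt0 r_gt0 s_gt0.
    have -> : ln (rho' h) = ln (rho h) + ln (sigma h) - ln (tau h).
      by rewrite /rho' ln_div ?posrE // lnM ?posrE.
    by rewrite /sigma ln_star_density //; ring.
  rewrite !meanD !meanZ.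
  have rho'1 : mean rho' = 1.
    rewrite -(glued_density_mean rhoP).
    transitivity (mean (fun h => rho' h * 1)).
      by apply: eq_mean => h; rewrite mulr1.
    by rewrite rho'_old //; apply: eq_mean => h; rewrite mulr1.
  (* Under [rho'] the set [S] has law [tau], so this is the relative entropy of the leaf law. *)
  have ent_tau : 0 <= mean (fun h => rho' h * ln (tau h)).
    have lntauD : depends_on S (fun h => ln (tau h)).
      exact: depends_on_comp (@depends_on_leaf S).
    rewrite rho'_old; last exact: depends_onS lntauD.
    rewrite (rhoE S) //; apply: mean_xlnx_ge0 => // [h|].
      exact: leaf_density_ge0.
    rewrite -(glued_density_mean rhoP).
    transitivity (mean (fun h => tau h * 1)).
      by apply: eq_mean => h; rewrite mulr1.
    by rewrite -(rhoE S) //; apply: eq_mean => h; rewrite mulr1.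
  (* The star without leaves is its centre, so this is the relative entropy of the degree-biased
     law. *)
  have ent_deg : 0 <= mean (fun h => rho' h * ln (degree_density (h v))).
    have star0 h : star_density v set0 h = degree_density (h v).
      by rewrite /star_density big_set0 mulr1.
    have vD (F : W -> R) : depends_on [set v] (fun h => F (h v)).
      by move=> h h' hh'; rewrite hh' // set11.
    rewrite rho'_new; last first.
      by apply: depends_onS (vD (fun x => ln (degree_density x))); rewrite subsetUl.
    rewrite (@mean_star_sub v (N v) set0) ?sub0set //; last first.
      apply: depends_onS (vD (fun x => ln (degree_density x))).
      by rewrite setD0 sub1set inE.
    rewrite (eq_mean
      (g := fun h => star_density v set0 h * ln (star_density v set0 h))).
      apply: mean_xlnx_ge0 => // [h|]; first exact: star_density_ge0.
      transitivity (mean (fun h => 1 * star_density v set0 h)).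
        by apply: eq_mean => h; rewrite mul1r.
      rewrite (@mean_star_leaf v set0 set0) ?inE //.
      rewrite -[RHS](mean_cst V W_gt0 1).
      by apply: eq_mean => h; rewrite leaf_density0 mulr1.
    by move=> h; rewrite star0 mulrC.
  rewrite rho'_old; last by apply: depends_on_comp; exact: depends_onS rhoD.
  rewrite rho'1 big_setU1 //= natrD mulrDl mulr1 [leRHS]addrC.
  apply: lerD => //; rewrite gerDl mulN1r mulNr -opprD oppr_le0 addr_ge0 //.
  by rewrite mulr_ge0 ?ler0n.
Qed.

End Gluing.
End Stars.

(** * Counting edges and homomorphisms *)

(** Each edge has exactly one endpoint in [A], so orienting it from there matches [edges H] with the
    pairs in [D]. *)
Lemma card_edges_bipartition (V : finType) (H : sgraph V) (A B : {set V}) :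
  bipartition H A B -> #|edges H| = (\sum_(u in A) #|neighbourhood H u|)%N.
Proof.
case=> AB dAB iA iB.
pose D := [set p : V * V | (p.1 \in A) && adj H p.1 p.2].
have leftA x y : adj H x y -> x \notin A -> y \in A.
  move=> xy xA; apply: contraLR isT => yA.
  have inB z : z \notin A -> z \in B.
    by move=> zA; have := in_setT z; rewrite -AB inE (negPf zA).
  by have := iB x y (inB _ xA) (inB _ yA); rewrite xy.
have -> : edges H = [set [set p.1; p.2] | p in D].
  apply/setP=> e; apply/imsetP/imsetP=> -[[x y]]; rewrite !inE /=.
    move=> xy ->; have [xA|xA] := boolP (x \in A).
      by exists (x, y); rewrite ?inE ?xA.
    by exists (y, x); rewrite /= 1?setUC // inE /= (leftA _ _ xy) // adj_sym.
  by case/andP=> _ xy ->; exists (x, y); rewrite ?inE.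
rewrite card_in_imset => [|[x y] [x' y']]; last first.
  rewrite !inE /= => /andP[xA xy] /andP[x'A xy'] eqs.
  have notA a b : a \in A -> adj H a b -> b \notin A.
    by move=> aA ab; apply: contraTN ab => bA; apply: iA.
  have: x \in [set x'; y'] by rewrite -eqs set21.
  rewrite !inE => /predU1P[xx'|/eqP xy'E]; last first.
    by move: (notA _ _ x'A xy'); rewrite -xy'E xA.
  have: y \in [set x'; y'] by rewrite -eqs set22.
  rewrite !inE => /predU1P[yx'|/eqP->]; last by rewrite xx'.
  by move: (notA _ _ xA xy); rewrite yx' x'A.
transitivity (\sum_(u in A) \sum_(b in neighbourhood H u) 1)%N.
  rewrite pair_big_dep /= -sum1_card; apply: eq_bigl => -[x y].
  by rewrite !inE.
by apply: eq_bigr => u _; rewrite sum1_card.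
Qed.

Lemma card_homs_K2 (W : finType) (G : sgraph W) :
  #|homs (complete_graph 2) G| = (\sum_x #|neighbourhood G x|)%N.
Proof.
transitivity #|[set p : W * W | adj G p.1 p.2]|; last first.
  transitivity (\sum_x \sum_(y in neighbourhood G x) 1)%N.
    by rewrite pair_big_dep /= -sum1_card; apply: eq_bigl => -[x y]; rewrite !inE.
  by apply: eq_bigr => u _; rewrite sum1_card.
pose F (p : W * W) : {ffun 'I_2 -> W} :=
  [ffun i => if i == ord0 then p.1 else p.2].
have F_inj : injective F.
  move=> [x y] [x' y'] /ffunP E.
  by have := E ord0; have := E ord_max; rewrite !ffunE /= => -> ->.
rewrite -(card_imset _ F_inj); apply: eq_card => f; rewrite inE.
apply/forallP/imsetP=> [hom|[[x y]]].
  exists (f ord0, f ord_max).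
    by rewrite inE /=; have /forallP/(_ ord_max) := hom ord0.
  apply/ffunP=> i; rewrite ffunE; case: eqP => [->//|].
  case: i => [[|[|//]]] i2 i0; first by case: i0; apply: val_inj.
  by congr (f _); apply: val_inj.
rewrite inE /= => xy -> i; apply/forallP=> j; rewrite !ffunE.
by case: i j => [[|[|//]]] ? [[|[|//]]] ?; apply/implyP => // _;
  rewrite //= adj_sym.
Qed.

Lemma mean_homs (R : realType) (V W : finType) (H : sgraph V) (G : sgraph W) :
  mean (fun h => (h \in homs H G)%:R) = ratr (hom_density H G) :> R.
Proof.
rewrite /mean fmorph_div rmorphXn /= !ratr_nat; congr (_ / _).
rewrite -sum1_card natr_sum [RHS]big_mkcond /=.
by apply: eq_bigr => h _; case: (h \in _).
Qed.

Lemma edge_densityE (R : realType) (W : finType) (G : sgraph W) :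
  edge_density R G = ratr (hom_density (complete_graph 2) G).
Proof.
rewrite fmorph_div rmorphXn /= !ratr_nat card_ord card_homs_K2 natr_sum.
by [].
Qed.

(** * Induction along the tree and conclusion *)

(** The tree path from [v] to any placed [w] passes through the parent [u], so arrangeability puts
    the common neighbours of [v] and [w] into the neighbourhood of [u]. Thus the placed neighbours
    of [v] lie in a single star. *)
Lemma tree_arrangeable_glued (R : realType) (V W : finType) (H : sgraph V)
    (G : sgraph W) (A B : {set V}) :
  (0 < #|W|)%N -> 0 < degree_sum R G ->
  bipartition H A B -> tree_arrangeable_set H A ->
  exists rho : {ffun V -> W} -> R, glued_density G H A rho.
Proof.
move=> W_gt0 M_gt0 [_ _ iA _] [T [_ [_ Tconn _] Tarr]].
have <- : val @: [set: {u | u \in A}] = A.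
  apply/setP=> x; apply/imsetP/idP => [[u _ ->]|xA]; first exact: valP.
  by exists (exist _ x xA).
apply: (connected_graph_ind (K := T)
  (Q := fun P => exists rho, @glued_density R V W G H (val @: P) rho)) => //.
  by rewrite imset0; exists (fun=> 1); apply: glued_density0.
move=> P v vP [rho rhoP] Pv; rewrite imsetU1.
have vP' : val v \notin val @: P by rewrite mem_imset //; exact: val_inj.
have [Nv0|Nv0] := eqVneq (neighbourhood H (val v)) set0.
  by exists rho; apply: glued_density_isolated.
apply: glued_density_extend rhoP => //.
- apply/bigcupP=> -[_ /imsetP[w _ ->]]; rewrite inE => wv.
  by have := iA _ _ (valP w) (valP v); rewrite wv.
- rewrite disjoint_sym; apply/pred0P => x /=; apply/andP => -[/imsetP[w _ ->]].
  by rewrite inE => vw; have := iA _ _ (valP v) (valP w); rewrite vw.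
- case: Pv => [->|[u uP Pu]].
    by left; rewrite imset0 /covered big_set0 setI0.
  right; exists (val u); first exact: imset_f.
  apply/subsetP=> b /setIP[bv /bigcupP[_ /imsetP[w wP ->] bw]].
  have [p vwp] := Pu _ wP.
  have: b \in neighbourhood H (val v) :&: neighbourhood H (val w).
    by rewrite inE bv bw.
  by rewrite (Tarr _ _ _ vwp) !big_cons => /setIP[_ /setIP[]].
Qed.

Theorem theorem1p1 (V : finType) (H : sgraph V) :
  bipartite H -> tree_arrangeable H -> sidorenko H.
Proof.
move=> _ [A [B [AB arrA]]] W G W_gt0.
(* Logarithms require real numbers, so the rational inequality is transferred to them. *)
pose R := Rdefinitions.R : realType.
rewrite -(ler_rat R) rmorphXn /= -edge_densityE -mean_homs.
have n_gt0 : 0 < #|W|%:R :> R by rewrite ltr0n.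
have mean_ge0 : 0 <= mean (fun h => (h \in homs H G)%:R) :> R.
  by rewrite divr_ge0 ?exprn_ge0 ?ler0n // sumr_ge0.
have : 0 <= degree_sum R G by rewrite sumr_ge0 // => x _; exact: ler0n.
rewrite le_eqVlt => /predU1P[M0|M_gt0].
  (* If [G] has no edges, the left side is 0 unless [H] has none either; then [0 ^+ 0 = 1] and every
     map is a homomorphism. *)
  rewrite /edge_density -M0 mul0r expr0n; case: eqP => // /eqP.
  rewrite cards_eq0 => /eqP E0; rewrite (eq_mean (g := fun=> 1)) ?mean_cst //.
  move=> h; rewrite inE.
  suff -> : [forall x, forall y, adj H x y ==> adj G (h x) (h y)] by [].
  apply/forallP=> x; apply/forallP=> y; apply/implyP => xy.
  suff: [set x; y] \in edges H by rewrite E0 inE.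
  by apply/imsetP; exists (x, y); rewrite ?inE.
have [rho rhoA] := tree_arrangeable_glued W_gt0 M_gt0 AB arrA.
have e_gt0 := edge_density_gt0 W_gt0 M_gt0.
have [rho0 _ rhoG _ rhoH] := rhoA.
have rho_hom h : rho h != 0 -> h \in homs H G.
  move=> /rhoG hA; rewrite inE; apply/forallP=> x; apply/forallP=> y.
  apply/implyP=> xy; have [xA|xA] := boolP (x \in A).
    by apply: hA => //; rewrite inE.
  rewrite adj_sym; apply: hA; last by rewrite inE adj_sym.
  case: AB => AB _ _ iB; apply: contraTT xy => yA; apply: iB.
    by have := in_setT x; rewrite -AB inE (negPf xA).
  by have := in_setT y; rewrite -AB inE (negPf yA).
have rho1 := glued_density_mean W_gt0 M_gt0 rhoA.
(* Support and entropy bounds combine to [- ln t_H(G) <= |E(H)| * - ln p]; it remains to remove the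
   logarithms. *)
have := le_trans (mean_supported W_gt0 rho0 rho_hom rho1) rhoH.
rewrite -(card_edges_bipartition AB) mulrN lerN2 mulr_natl -lnXn // ler_ln //.
  by rewrite posrE exprn_gt0.
have [h h0] : exists h, 0 < rho h.
  by apply: (mean_neq0_exists_gt0 W_gt0) => //; rewrite rho1 oner_eq0.
rewrite posrE divr_gt0 ?exprn_gt0 // (bigD1 h) //= rho_hom ?gt_eqF //.
by rewrite ltr_pwDl ?ltr01 // sumr_ge0.
Qed.
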